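(* Let $G$ be a finite abelian group (written additively), let $s$ be a positive integer, and let $A \subseteq G$ be a perfect $s$-basis of $G$. Then either $s=1$ and $A=G\setminus\{0\}$, or $G\cong \mathbb{Z}_{s+1}$ and $|A|=1$.
   Context: For a subset $A$ of $G$ and an integer $h\ge 0$, $hA$ denotes the set of all sums of exactly $h$ not-necessarily-distinct elements of $A$ (with $0A=\{0\}$). A subset $A\subseteq G$ is a perfect $s$-basis of $G$ if every element of $G$ can be written as a sum of at most $s$ (not-necessarily-distinct) elements of $A$, i.e. $\bigcup_{h=0}^{s} hA = G$, and this representation is unique apart from the order of the terms (the empty sum representing $0$ counts as a representation). $\mathbb{Z}_n=\mathbb{Z}/n\mathbb{Z}$.
   Formalization: The formal theorem assumes in addition that s = 1 or G is nontrivial; this excludes only G = {0}, A = ∅, s ≥ 2, where A is a perfect s-basis but neither alternative of the conclusion holds. *)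

(* Defs.v *)
From HB Require Import structures.
From mathcomp Require Import all_boot all_order all_algebra all_fingroup.

Set Implicit Arguments.
Unset Strict Implicit.
Unset Printing Implicit Defensive.

Import GRing.Theory.
Local Open Scope ring_scope.

(* $hA$; the only 0-tuple is empty, so sumset 0 A = [set 0] even for A = set0. *)
Definition sumset (G : finZmodType) (h : nat) (A : {set G}) : {set G} :=
  [set \sum_(x <- t) x | t : h.-tuple G & all [in A] t].

(* A representation is a sequence of elements of A; perm_eq disregards the
   order of the terms but keeps multiplicities.  The two sequences compared may
   have different lengths, and either may be empty. *)
Definition perfect_basis (G : finZmodType) (s : nat) (A : {set G}) : Prop :=
  \bigcup_(h < s.+1) sumset h A = [set: G] /\
  forall t u : seq G,
    all [in A] t -> all [in A] u -> (size t <= s)%N -> (size u <= s)%N ->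
    \sum_(x <- t) x = \sum_(x <- u) x -> perm_eq t u.

(* Main.v *)
(** Let [rep x] be the representation of [x] in terms of at most [s] elements
   of [A].  If [A] is a perfect [s]-basis, consider the pairs [(x, a)] with [a]
   in [A], [rep x] shorter than [s], and [a] not occurring in [rep x].  The map
   [(x, a) |-> x - a] is injective, with values among the elements whose
   representation has length exactly [s].  The map sending [(x, a)] to [x] plus
   enough copies of [a] to reach length [s] is onto these elements.  Hence both
   maps are bijective; but if [s > 1] and [a], [b] are distinct elements of [A],
   the second map sends [(b, a)] and [((s - 1) a, b)] to the same element. *)
Require Import Defs.
From HB Require Import structures.
From mathcomp Require Import all_boot all_order all_algebra all_fingroup.
From mathcomp Require Import cyclic.

Set Implicit Arguments.
Unset Strict Implicit.
Unset Printing Implicit Defensive.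

Import GRing.Theory.
Local Open Scope ring_scope.

Lemma sum_nseq (V : nmodType) (n : nat) (a : V) :
  \sum_(x <- nseq n a) x = a *+ n.
Proof. by elim: n => [|n IHn]; rewrite ?big_nil //= big_cons IHn mulrS. Qed.

Lemma perfect_basis_repr (G : finZmodType) (s : nat) (A : {set G}) :
  perfect_basis s A ->
  exists rep : G -> seq G, forall g,
    [/\ all [in A] (rep g), (size (rep g) <= s)%N & \sum_(x <- rep g) x = g].
Proof.
case=> coverA _; suff repr g : exists t,
    [/\ all [in A] t, (size t <= s)%N & \sum_(x <- t) x = g].
  (* Finiteness of [G] permits choosing one representation for every element at once. *)
  by have [rep repP] := fin_all_exists repr; exists rep.
have /bigcupP[h _ /imsetP[t At ->]] : g \in \bigcup_(h < s.+1) sumset h A.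
  by rewrite coverA inE.
by exists t; split=> [|| //];
   [move: At; rewrite inE | rewrite size_tuple leq_ord].
Qed.

Lemma perfect_basis_card_le1 (G : finZmodType) (s : nat) (A : {set G}) :
  (1 < s)%N -> perfect_basis s A -> (#|A| <= 1)%N.
Proof.
move=> s_gt1 perfA; have [rep repP] := perfect_basis_repr perfA.
have [_ uniqA] := perfA.
have rep_sum t : all [in A] t -> (size t <= s)%N ->
    perm_eq (rep (\sum_(x <- t) x)) t.
  by move=> At szt; have [Ar szr sumr] := repP (\sum_(x <- t) x); apply: uniqA.
pose P := [set p : G * G |
  [&& p.2 \in A, size (rep p.1) < s & p.2 \notin rep p.1]%N].
pose Z := [set z | size (rep z) == s].
pose phi (p : G * G) := p.1 - p.2.
pose psi (p : G * G) := p.1 + p.2 *+ (s - size (rep p.1)).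
have phi_inj : {in P &, injective phi}.
  move=> [x a] [y b]; rewrite !inE /phi /=.
  move=> /and3P[Aa szx nax] /and3P[Ab szy _].
  move=> eq_phi; have [[Ax _ sumx] [Ay _ sumy]] := (repP x, repP y).
  (* From [x - a = y - b] follows [b + x = a + y]. Since [rep x] and [rep y] are shorter than [s],
     one more term keeps both sides within the length bound. *)
  have eq_xy : perm_eq (b :: rep x) (a :: rep y).
    apply: uniqA; rewrite /= ?Aa ?Ab // !big_cons sumx sumy.
    by rewrite -[x](subrK a) eq_phi addrA [b + _]addrC subrK addrC.
  have /eqP eq_ab : a == b.
    by move: (perm_mem eq_xy a); rewrite !inE eqxx (negPf nax) orbF.
  by move: eq_phi; rewrite eq_ab => /addIr ->.
have phi_Z : phi @: P \subset Z.
  apply/subsetP=> _ /imsetP[[x a] + ->]; rewrite !inE /phi /=.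
  move=> /and3P[Aa szx nax].
  have [Ax _ sumx] := repP x; have [Ad szd sumd] := repP (x - a).
  rewrite eqn_leq szd leqNgt; apply: contra nax => ltd.
  (* If [rep (x - a)] had room for one more term, adding [a] would represent [x] with [a]
     occurring. *)
  have /perm_mem <- : perm_eq (a :: rep (x - a)) (rep x).
    apply: uniqA; rewrite /= ?Aa //; first exact: ltnW.
    by rewrite big_cons sumd sumx addrC subrK.
  exact: mem_head.
have psi_Z : Z \subset psi @: P.
  apply/subsetP=> z; rewrite inE => /eqP szz; have [Az _ sumz] := repP z.
  have [a az] : exists a, a \in rep z.
    by case: (rep z) szz s_gt1 => [<- //|a r _ _]; exists a; exact: mem_head.
  (* Deleting every copy of [a] from [rep z] gives the first component of a preimage; [psi] restores
     exactly the deleted copies. *)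
  pose r := [seq x <- rep z | x != a].
  have szr : (size r + count_mem a (rep z))%N = s.
    by rewrite size_filter addnC count_predC.
  have a_gt0 : (0 < count_mem a (rep z))%N by rewrite -has_count has_pred1.
  have ltr : (size r < s)%N by rewrite -szr -addn1 leq_add2l.
  have pr : perm_eq (rep (\sum_(x <- r) x)) r.
    apply: rep_sum (ltnW ltr); rewrite all_filter.
    by apply: sub_all Az => x /= ->; rewrite implybT.
  apply/imsetP; exists (\sum_(x <- r) x, a).
    rewrite inE /= (perm_size pr) ltr (perm_mem pr) mem_filter eqxx /= andbT.
    exact: (allP Az).
  rewrite /psi /= (perm_size pr) -szr addKn -[LHS]sumz.
  rewrite (bigID (pred1 a)) /= addrC big_filter; congr (_ + _).
  rewrite (eq_bigr (fun=> a)) => [|x /eqP //].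
  by rewrite big_const_seq iter_addr_0.
have psi_inj : {in P &, injective psi}.
  (* The chain [#|P| = #|phi @: P| <= #|Z| <= #|psi @: P| <= #|P|] forces equality throughout. *)
  apply/imset_injP; rewrite eqn_leq leq_imset_card -(card_in_imset phi_inj).
  exact: leq_trans (subset_leq_card phi_Z) (subset_leq_card psi_Z).
rewrite leqNgt; apply/negP=> /card_gt1P[a [b [Aa Ab neq_ab]]].
have pb : perm_eq (rep b) [:: b].
  by have := @rep_sum [:: b]; rewrite big_seq1 /= Ab ltnW //; apply.
have pa : perm_eq (rep (a *+ s.-1)) (nseq s.-1 a).
  by rewrite -sum_nseq rep_sum ?size_nseq ?leq_pred // all_nseq /= Aa orbT.
(* Both pairs go to [b + a *+ s.-1]: the first lacks [s - 1] terms, the second only one. *)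
have : (b, a) = (a *+ s.-1, b).
  apply: psi_inj; rewrite ?inE /psi /= ?(perm_size pb) ?(perm_size pa)
    ?(perm_mem pb) ?(perm_mem pa) ?size_nseq.
  - by rewrite Aa s_gt1 inE.
  - rewrite Ab prednK ?leqnn ?(ltnW s_gt1) //.
    by rewrite mem_nseq eq_sym (negPf neq_ab) andbF.
  - by rewrite -subn1 subKn ?(ltnW s_gt1) // mulr1n addrC.
by case=> _ eq_ab; rewrite eq_ab eqxx in neq_ab.
Qed.

Lemma perfect_basis1 (G : finZmodType) (A : {set G}) :
  perfect_basis 1 A -> A = [set: G] :\ 0.
Proof.
move=> perfA; have [rep repP] := perfect_basis_repr perfA.
have [_ uniqA] := perfA; apply/setP=> g; rewrite !inE andbT.
apply/idP/idP=> [Ag | nz_g].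
  apply/eqP=> g0; rewrite g0 in Ag.
  (* If [0] were in [A], it would have both a one-term and an empty representation. *)
  have := uniqA [:: 0] [::]; rewrite big_seq1 big_nil /= Ag.
  by move=> /(_ isT isT isT isT erefl) /perm_size.
have [] := repP g; case: (rep g) => [|x [|y r]] //=.
  by move=> _ _; rewrite big_nil => g0; rewrite -g0 eqxx in nz_g.
by rewrite andbT big_seq1 => Ax _ <-.
Qed.

(** A representation over one generator is just a multiplicity from [0] to [s], so the multiples
    [a *+ i] list [G] without repetition. *)
Lemma perfect_basis_set1_isog (G : finZmodType) (s : nat) (a : G) :
  (0 < s)%N -> perfect_basis s [set a] -> ([set: G] \isog [set: 'Z_s.+1])%g.
Proof.
move=> s_gt0 perfA; have [rep repP] := perfect_basis_repr perfA.
have [_ uniqA] := perfA.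
pose f (i : 'I_s.+1) := a *+ i.
have f_inj : injective f.
  move=> i j eq_f; apply: val_inj => /=.
  have /perm_size : perm_eq (nseq i a) (nseq j a).
    by apply: uniqA; rewrite ?all_nseq /= ?set11 ?orbT // ?size_nseq ?leq_ord
         ?sum_nseq.
  by rewrite !size_nseq.
have f_onto g : exists i, g = f i.
  have [Ag szg sumg] := repP g.
  have Dr : rep g = nseq (size (rep g)) a.
    by apply/all_pred1P; apply: sub_all Ag => x; rewrite /= inE.
  exists (Ordinal (szg : (size (rep g) < s.+1)%N)).
  by rewrite /f /= -[LHS]sumg {1}Dr sum_nseq.
have cardG : #|[set: G]| = s.+1.
  have -> : [set: G] = f @: 'I_s.+1.
    by apply/setP=> g; have [i ->] := f_onto g; rewrite inE imset_f.
  by rewrite card_imset // card_ord.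
have cycG : cyclic [set: G].
  apply/cyclicP; exists a; apply/setP=> g; have [i ->] := f_onto g.
  by rewrite inE /f -FinRing.zmodXgE mem_cycle.
have cycZ : cyclic [set: 'Z_s.+1] by rewrite Zp_cycle cycle_cyclic.
rewrite isog_cyclic_card // cycZ; apply/eqP; rewrite [RHS]cardG.
(* ['Z_n] has [n] elements only for [n > 1]; here [s_gt0] ensures this. *)
by rewrite cardsT card_ord Zp_cast.
Qed.

(** [nondegenerate] excludes the trivial group with [A = set0], a perfect basis for every [s] that
    fits neither alternative when [s > 1]. *)
Theorem theorem1 (G : finZmodType) (s : nat) (A : {set G})
    (s_gt0 : (0 < s)%N) (nondegenerate : s = 1%N \/ (1 < #|G|)%N)
    (perfA : perfect_basis s A) :
  (s = 1%N /\ A = [set: G] :\ 0) \/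
  (([set: G] \isog [set: 'Z_s.+1])%g /\ #|A| = 1%N).
Proof.
have [s1 | s_neq1] := eqVneq s 1%N.
  by left; split=> //; apply: perfect_basis1; rewrite -s1.
right; have s_gt1 : (1 < s)%N by rewrite ltn_neqAle eq_sym s_neq1.
have [A1 | [a DA]] : A = set0 \/ exists a, A = [set a].
  have := perfect_basis_card_le1 s_gt1 perfA.
  case: (posnP #|A|) => [/eqP | A_gt0 A_le1].
    by rewrite cards_eq0 => /eqP; left.
  by right; apply/cards1P; rewrite eqn_leq A_le1.
- case: nondegenerate => [/eqP | ]; first by rewrite (negPf s_neq1).
  have [rep repP] := perfect_basis_repr perfA.
  (* Over an empty [A] only the empty sum exists. *)
  have all0 (g : G) : g = 0.
    have [+ _ <-] := repP g; rewrite A1.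
    by case: (rep g) => [|x r]; rewrite ?big_nil //= inE.
  by case/card_gt1P=> x [y [_ _]]; rewrite [x]all0 [y]all0 eqxx.
- rewrite DA cards1 in perfA *.
  by split=> //; apply: perfect_basis_set1_isog perfA.
Qed.
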